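(* Let $\kappa$ be an infinite cardinal and let $K_\kappa$ be the complete graph on $\kappa$. (1) If $\kappa$ is regular and $\kappa\nrightarrow[\kappa;\kappa]^2_2$, then there is an orientation $D$ of $K_\kappa$ such that for every $W\subseteq\kappa$ with $\chi(K_\kappa[W])=\kappa$ (i.e. $|W|=\kappa$) and every integer $n\geq3$, the directed cycle $\vec C_n$ is a subdigraph of $D[W]$. (2) If $\lambda$ is an uncountable cardinal, then there is an orientation $D$ of $K_{\lambda^+}$ such that for every colouring of the vertices of $D$ with $\lambda$ colours and every integer $n\geq 3$ there is a monochromatic copy of $\vec C_n$ in $D$.
   Context: An orientation of an undirected graph $G$ is a digraph on the same vertex set containing, for each edge $uv$ of $G$, exactly one of the arcs $uv$, $vu$, and no other arcs. $\vec C_n$ is the directed cycle on $n$ vertices; copies/subdigraphs are not necessarily induced. $\kappa\nrightarrow[\kappa;\kappa]^2_2$ means there is $f:[\kappa]^2\to 2$ such that for all $A,B\subseteq\kappa$ of size $\kappa$ and each $i<2$ there are $\alpha\in A$, $\beta\in B$ with $\alpha<\beta$ and $f(\alpha,\beta)=i$. *)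

(* Defs.v *)
From HB Require Import structures.
From mathcomp Require Import all_boot all_order.
From mathcomp Require Import boolp classical_sets cardinality.
Set Implicit Arguments. Unset Strict Implicit. Unset Printing Implicit Defensive.
Local Open Scope classical_set_scope.
Local Open Scope card_scope.

Definition orientation_of_complete (T : Type) (D : T -> T -> Prop) : Prop :=
  (forall x, ~ D x x) /\
  (forall x y, x <> y -> (D x y /\ ~ D y x) \/ (D y x /\ ~ D x y)).

Definition has_dicycle (T : Type) (D : T -> T -> Prop) (W : set T) (n : nat) : Prop :=
  exists v : nat -> T,
    (forall i j, (i < n)%N -> (j < n)%N -> v i = v j -> i = j) /\
    (forall i, (i < n)%N -> W (v i)) /\
    (forall i, (i < n)%N -> D (v i) (v (i.+1 %% n)%N)).

(* (K, lt) is an infinite cardinal kappa, viewed as the initial von Neumann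
   ordinal: lt is a strict well-order on K, K is infinite, and every proper
   initial segment has cardinality < |K|. *)
Definition infinite_cardinal (K : Type) (lt : K -> K -> Prop) : Prop :=
  (forall x, ~ lt x x) /\
  (forall x y z, lt x y -> lt y z -> lt x z) /\
  (forall x y, x <> y -> lt x y \/ lt y x) /\
  well_founded lt /\
  infinite_set [set: K] /\
  (forall x : K, ~ ([set: K] #<= [set y | lt y x])).

Definition regular_cardinal (K : Type) (lt : K -> K -> Prop) : Prop :=
  forall A : set K, ~ ([set: K] #<= A) -> exists b, forall a, A a -> lt a b.

Definition neg_sq_bracket (K : Type) (lt : K -> K -> Prop) : Prop :=
  exists f : K -> K -> bool,
    forall A B : set K, A #= [set: K] -> B #= [set: K] ->
      forall i : bool, exists a b, A a /\ B b /\ lt a b /\ f a b = i.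

Definition succ_cardinal (L K : Type) : Prop :=
  [set: L] #<= [set: K] /\ ~ ([set: K] #<= [set: L]) /\
  (forall A : set K, A #<= [set: L] \/ [set: K] #<= A).

Definition uncountable_type (L : Type) : Prop := ~ countable [set: L].

(* Main.v *)
(** In both parts [a < b] are joined upwards or downwards according to a binary
    predicate [up], and cycles are made of an increasing path of upward arcs
    closed by one downward arc.

    (1) [up] is the given colouring. By regularity, all but boundedly many
    points of [W] send arcs up to, and receive arcs from, unboundedly many
    larger points of [W]; a rectangle instance of the hypothesis closes a cycle
    of any length.

    (2) No strong colouring is needed. Well-order [K] in type lambda^+ and fix,
    for each [d] of cofinality omega, a sequence [r d] cofinal in [d]. For
    [x < y], the arc goes down from [y] to [x] iff [r x] and [r y] agree up to
    the first [n] with [r y n >= x]. Some colour class [W] is stationary. For a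
    finite sequence [s] let [W_s] be the set of [d] in [W] such that [r d]
    extends [s]; by pressing down, if [W_s] is stationary then there is [t]
    extending [s] such that [W_(t,x)] is stationary for unboundedly many [x].
    Points beyond a fixed bound from [W_(t,a)] and [W_(t,b)], [a <> b], are
    joined upwards, since their sequences split early; whereas
    a downward arc occurs inside [W_(t,a)]: split it at [t'], take [x] in
    [W_t'], then [z >= x] and [y] in [W_(t',z)]. *)

Require Import Defs.
From Stdlib Require Import Wellfounded.
From mathcomp Require Import all_boot all_order.
From mathcomp Require Import boolp classical_sets cardinality.
From mathcomp Require Import functions wochoice.
Set Implicit Arguments. Unset Strict Implicit. Unset Printing Implicit Defensive.
Local Open Scope classical_set_scope.
Local Open Scope card_scope.

(** * Cardinal arithmetic and well-orders *)

Lemma card_le_of_inj (T U : Type) (A : set T) (B : set U) (f : T -> U) :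
  (forall x, A x -> B (f x)) ->
  (forall x y, A x -> A y -> f x = f y -> x = y) -> A #<= B.
Proof.
move=> fAB finj.
have : exists2 g : T -> U, set_fun A B g & set_inj A g.
  by exists f => // x y /set_mem Ax /set_mem Ay; apply: finj.
by move/injfunPex => [g]; apply: inj_card_le.
Qed.

Lemma inj_of_card_le (T U : Type) (A : set T) (B : set U) :
  A !=set0 -> A #<= B -> exists f : T -> U,
    (forall x, A x -> B (f x)) /\
    (forall x y, A x -> A y -> f x = f y -> x = y).
Proof.
move=> [x0 Ax0] /card_leP[f].
pose emb x (Ax : A x) : A := SigSub (mem_set Ax).
(* Points outside [A] get the image of [x0], a default that makes the map total on [T]. *)
exists (fun x => if pselect (A x) is left Ax then val (f (emb x Ax))
                 else val (f (emb x0 Ax0))).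
split=> [x Ax|x y Ax Ay]; case: pselect => // Ax'.
  exact: set_mem (valP (f _)).
case: pselect => // Ay' /val_inj/(@inj _ _ _ f); rewrite !inE => /(_ I I).
by move/(congr1 val).
Qed.

Lemma card_le_square (T U : Type) (A : set T) (B : set U) :
  A #<= B -> A `*` A #<= B `*` B.
Proof.
move=> AB; have [->|/set0P A0] := eqVneq A set0; first by rewrite set0X.
have [f [fB finj]] := inj_of_card_le A0 AB.
apply: (@card_le_of_inj _ _ _ _ (fun p => (f p.1, f p.2))).
  by move=> [x y] [/= Ax Ay]; split; apply: fB.
move=> [x y] [x' y'] [/= Ax Ay] [/= Ax' Ay'] [e1 e2].
by congr pair; apply: finj.
Qed.

Lemma card_le_setU1 (T U : Type) (A : set T) (B : set U) (a : T) :
  infinite_set B -> A #<= B -> A `|` [set a] #<= B.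
Proof.
move=> /infiniteP; have N0 : [set: nat] !=set0 by exists 0%N.
move=> /(inj_of_card_le N0) [e [eB' einj']] AB.
have eB n : B (e n) by apply: eB'.
have {einj'} einj n m : e n = e m -> n = m by apply: einj'.
have [A0|/set0P A0] := eqVneq A set0.
  apply: (@card_le_of_inj _ _ _ _ (fun=> e 0%N)) => [_ _|]; first exact: eB.
  by move=> x y; rewrite A0 set0U => -> ->.
have [f [fB finj]] := inj_of_card_le A0 AB.
(* Hilbert's hotel along [e] frees the point [e 0] for [a]. *)
have /choice[sh shP] (u : U) : exists v,
    (forall n, u = e n -> v = e n.+1) /\ ((forall n, u <> e n) -> v = u).
  have [[n ->]|H] := pselect (exists n, u = e n).
    exists (e n.+1); split=> [m /einj ->//|/(_ n)//].
  by exists u; split=> // n un; case: H; exists n.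
have shB u : B u -> B (sh u).
  move=> Bu; have [[n un]|H] := pselect (exists n, u = e n).
    by rewrite ((shP u).1 _ un); apply: eB.
  by rewrite (shP u).2 // => n un; apply: H; exists n.
have sh0 u : sh u <> e 0%N.
  have [[n un]|H] := pselect (exists n, u = e n).
    by rewrite ((shP u).1 _ un) => /einj.
  have Hu : forall n, u <> e n by move=> n un; apply: H; exists n.
  by rewrite (shP u).2.
have shinj u v : sh u = sh v -> u = v.
  have [[n un]|H] := pselect (exists n, u = e n);
  have [[m vm]|H'] := pselect (exists n, v = e n).
  - by rewrite ((shP u).1 _ un) ((shP v).1 _ vm) un vm => /einj[->].
  - have Hv : forall n, v <> e n by move=> k vk; apply: H'; exists k.
    by rewrite ((shP u).1 _ un) (shP v).2 // => /esym/Hv.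
  - have Hu : forall n, u <> e n by move=> k uk; apply: H; exists k.
    by rewrite ((shP v).1 _ vm) (shP u).2 // => /Hu.
  - have Hu : forall n, u <> e n by move=> k uk; apply: H; exists k.
    have Hv : forall n, v <> e n by move=> k vk; apply: H'; exists k.
    by rewrite (shP v).2 // (shP u).2.
have /choice[g gP] (x : T) : exists u,
    (x = a -> u = e 0%N) /\ (x <> a -> u = sh (f x)).
  have [->|xa] := pselect (x = a).
    by exists (e 0%N).
  by exists (sh (f x)).
have gN x : x <> a -> g x = sh (f x) by move=> xa; apply: (gP x).2.
have ga x : x = a -> g x = e 0%N by move=> xa; apply: (gP x).1.
apply: (@card_le_of_inj _ _ _ _ g) => [x [Ax|->]|x y Ax Ay].
- have [->|xa] := pselect (x = a); first by rewrite ga //; apply: eB.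
  by rewrite gN //; apply/shB/fB.
- by rewrite ga //; apply: eB.
have [->|xa] := pselect (x = a); have [->//|ya] := pselect (y = a).
- by rewrite (ga a) // gN // => /esym/sh0.
- by rewrite (ga a) // gN // => /sh0.
rewrite !gN // => /shinj/finj; apply; [by case: Ax|by case: Ay].
Qed.

(** * Strict well-orders and recursion along them *)

Definition strict_well_order (T : Type) (lt : T -> T -> Prop) : Prop :=
  [/\ (forall x, ~ lt x x), (forall x y z, lt x y -> lt y z -> lt x z),
      (forall x y, x <> y -> lt x y \/ lt y x) & well_founded lt].

Lemma wf_min (T : Type) (lt : T -> T -> Prop) (P : set T) :
  well_founded lt -> P !=set0 -> exists2 x, P x & forall y, lt y x -> ~ P y.
Proof.
move=> wf [x0 Px0]; apply: contrapT => H.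
elim/(well_founded_ind wf): x0 Px0 => x IH Px; apply: H; exists x => // y /IH.
Qed.

Lemma exists_strict_well_order (T : Type) :
  exists lt : T -> T -> Prop, strict_well_order lt.
Proof.
have [R Rwo] := well_ordering_principle {classic T}.
have Rmin (P : set T) : P !=set0 -> exists2 z, P z & forall y, P y -> R z y.
  move=> [x Px]; have : nonempty (fun x : {classic T} => `[< P x >]).
    by exists x; apply/asboolP.
  move/Rwo => [z [[/asboolP Pz zmin] _]]; exists z => // y Py.
  by apply: zmin; apply/asboolP.
have Rxx x : R x x.
  have [|z -> zmin] := Rmin [set x]; [by exists x|exact: zmin].
have Rtot x y : R x y \/ R y x.
  have [|z [->|->] zmin] := Rmin [set x; y]; first by exists x; left.
    by left; apply: zmin; right.
  by right; apply: zmin; left.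
(* Uniqueness of the least element of a pair gives antisymmetry; transitivity, further down, comes
   from the least of three points. *)
have Ranti x y : R x y -> R y x -> x = y.
  move=> xy yx; have : nonempty (fun z : {classic T} => `[< z = x \/ z = y >]).
    by exists x; apply/asboolP; left.
  move/Rwo => [z [_ zuniq]]; transitivity z; [apply: esym|]; apply: zuniq.
    by split=> [|u /asboolP[]->//]; apply/asboolP; left.
  by split=> [|u /asboolP[]->//]; apply/asboolP; right.
exists (fun x y => R x y /\ x <> y); split.
- by move=> x [].
- move=> x y z [xy nxy] [yz nyz]; have [|u uP umin] := Rmin [set x; y; z].
    by exists x; left; left.
  have ux : u = x.
    case: uP => [[]//|] -> in umin *.
      by case: nxy; apply: Ranti => //; apply: umin; left; left.
    by case: nyz; apply: Ranti => //; apply: umin; left; right.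
  split; first by rewrite -ux; apply: umin; right.
  by move=> xz; apply: nxy; apply: Ranti; rewrite // xz.
- by move=> x y nxy; case: (Rtot x y) => H; [left|right]; split=> // /esym.
- move=> x; apply: contrapT => nacc.
  have [|z nz zmin] := Rmin [set z | ~ Acc (fun x y => R x y /\ x <> y) z].
    by exists x.
  apply: nz; constructor=> y [yz nyz]; apply: contrapT => /zmin zy.
  by apply: nyz; apply: Ranti.
Qed.

(** The choice at [p] depends only on the set of earlier values. Satisfiability of [Phi] is a
    premise at each [p], so that it can be proved from the values already known. *)
Lemma wf_recursive_choice (A B : Type) (lt : A -> A -> Prop) (Phi : set B -> B -> Prop) :
  well_founded lt -> inhabited B ->
  exists g : A -> B, forall p,
    (exists b, Phi (g @` [set q | lt q p]) b) ->
    Phi (g @` [set q | lt q p]) (g p).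
Proof.
move=> wf [b0].
have /choice[ch chP] (S : set B) : exists b', (exists b, Phi S b) -> Phi S b'.
  have [[b Sb]|H] := pselect (exists b, Phi S b).
    by exists b.
  by exists b0 => /H.
pose step p (rec : forall q, lt q p -> B) :=
  ch [set b | exists q (h : lt q p), rec q h = b].
pose g := Fix wf (fun=> B) step.
exists g => p ex; rewrite {2}/g Fix_eq -/g.
  suff -> : step p (fun q _ => g q) = ch (g @` [set q | lt q p]) by apply: chP.
  congr ch; apply/seteqP; split=> b; first by move=> [q [h <-]]; exists q.
  by move=> [q h <-]; exists q, h.
move=> q f1 f2 H; congr ch; apply/seteqP.
by split=> b [q' [h <-]]; exists q', h; rewrite H.
Qed.

(** Greedy injection: each [p] picks a point of [B] missed so far, which exists because the earlier
    part of [P] is too small to cover [B]. *)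
Lemma card_le_segments (A U : Type) (lt : A -> A -> Prop) (P : set A) (B : set U) :
  strict_well_order lt ->
  (forall p, P p -> ~ (B #<= [set q | P q /\ lt q p])) -> P #<= B.
Proof.
move=> [irr tr tot wf] small.
have [->//|/set0P[p0 Pp0]] := eqVneq P set0.
have [B0|/set0P[b0 _]] := eqVneq B set0.
  by case: (small p0 Pp0); rewrite B0.
pose lt' q p := P q /\ lt q p.
have wf' : well_founded lt' by apply: (wf_incl _ _ _ _ wf) => q p [].
have [g gP] := @wf_recursive_choice A U lt' (fun S b => B b /\ ~ S b) wf' (inhabits b0).
have {}gP p : P p -> B (g p) /\ ~ (g @` [set q | lt' q p]) (g p).
  move=> Pp; apply: gP; apply: contrapT => H; apply: (small p Pp).
  apply: card_le_trans (card_image_le g _); apply: subset_card_le => b Bb.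
  by apply: contrapT => nb; apply: H; exists b.
apply: (@card_le_of_inj _ _ _ _ g) => [p /gP[]//|x y Px Py gxy].
apply: contrapT => /tot[xy|yx].
  by case: (gP y Py) => _; apply; exists x.
by case: (gP x Px) => _; apply; exists y.
Qed.

Lemma strict_well_order_lex (A B : Type) (ltA : A -> A -> Prop) (ltB : B -> B -> Prop) :
  strict_well_order ltA -> strict_well_order ltB ->
  strict_well_order (fun p q : A * B =>
    ltA p.1 q.1 \/ (p.1 = q.1 /\ ltB p.2 q.2)).
Proof.
move=> [irrA trA totA wfA] [irrB trB totB wfB]; split.
- by move=> [a b] /= [/irrA//|[_ /irrB]].
- move=> [a b] [a' b'] [a'' b''] /= [h|[-> h]] [h'|[<- h']].
  + by left; apply: trA h'.
  + by left.
  + by left.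
  + by right; split=> //; apply: trB h'.
- move=> [a b] [a' b'] ne /=; have [aa|/totA[]] := pselect (a = a').
  + rewrite aa in ne *; have /totB[] : b <> b' by move=> bb; rewrite bb in ne.
      by left; right.
    by right; right.
  + by left; left.
  + by right; left.
- move=> [a b]; elim/(well_founded_ind wfA): a b => a IHa b.
  elim/(well_founded_ind wfB): b => b IHb; constructor=> -[a' b'] /= [|[->]].
    by move/IHa.
  exact: IHb.
Qed.

Lemma strict_well_order_inj (A B : Type) (f : A -> B) (lt : B -> B -> Prop) :
  injective f -> strict_well_order lt ->
  strict_well_order (fun x y => lt (f x) (f y)).
Proof.
move=> finj [irr tr tot wf]; split.
- by move=> x; apply: irr.
- by move=> x y z; apply: tr.
- by move=> x y xy; apply: tot => /finj.
- exact: (@wf_inverse_image _ _ lt f wf).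
Qed.

(* In the well-order of [T * T] by maximum first, each initial segment of
   [S `*` S] lies in the square of a proper initial segment of [S]. *)
Lemma card_le_square_initial (T : Type) (lt : T -> T -> Prop) (S : set T) :
  strict_well_order lt -> infinite_set S ->
  (forall x, S x -> ~ (S #<= [set y | lt y x])) ->
  (forall x, S x -> infinite_set [set y | lt y x] ->
    [set y | lt y x] `*` [set y | lt y x] #<= [set y | lt y x]) ->
  S `*` S #<= S.
Proof.
move=> wo Sinf Snot IH; have [irr tr tot wf] := wo.
pose mx (p : T * T) : T := if `[< lt p.1 p.2 >] then p.2 else p.1.
have mxP (p : T * T) : ~ lt (mx p) p.1 /\ ~ lt (mx p) p.2.
  rewrite /mx; case: asboolP => h; split=> //; do ?exact: irr.
  by move=> h'; apply: (irr p.1); apply: tr h'.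
have mxS p : (S `*` S) p -> S (mx p).
  by move=> [S1 S2]; rewrite /mx; case: ifP.
clearbody mx.
(* Keeping [p] behind its maximum makes the key injective, so the pulled-back lexicographic order is
   still total. *)
have finj : injective (fun p : T * T => (mx p, p)) by move=> p q [].
have wo2 := strict_well_order_inj finj
  (strict_well_order_lex wo (strict_well_order_lex wo wo)).
apply: (card_le_segments wo2) => p /mxS Sm Sle.
pose m := mx p; pose C := [set y | lt y m] `|` [set m].
have {Sle} SC : S #<= C `*` C.
  apply: card_le_trans Sle _; apply: subset_card_le => q [_ qp].
  have : ~ lt m (mx q).
    move=> h; case: qp => /= [h'|[h' _]].
      by apply: (irr m); apply: tr h'.
    by rewrite h' in h; apply: irr h.
  move: (mxP q) => [h1 h2] h.
  have aux z : ~ lt (mx q) z -> C z.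
    move=> hz; have [->|/tot[]] := pselect (z = m); [by right|by left|].
    have [qm|/tot[] // h3] := pselect (mx q = m); first by rewrite qm in hz.
    by move=> /(tr _ _ _ h3).
  by split; apply: aux.
have [fin|inf] := pselect (finite_set [set y | lt y m]).
  apply: Sinf; apply: card_le_finite SC _.
  have : finite_set C by rewrite finite_setU; split=> //; apply: finite_set1.
  by move=> Cfin; apply: finite_setX.
apply: (Snot m Sm); apply: card_le_trans SC (card_le_trans _ (IH m Sm inf)).
by apply: card_le_square; apply: card_le_setU1.
Qed.

(** Hessenberg's theorem, by induction over initial segments: a segment that injects into a shorter
    one inherits the bound, any other falls under [card_le_square_initial]. *)
Lemma card_le_square_infinite (T : Type) :
  infinite_set [set: T] -> [set: T * T] #<= [set: T].
Proof.
move=> Tinf; have [lt wo] := exists_strict_well_order T.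
have [irr tr tot wf] := wo.
pose seg x := [set y | lt y x].
have segsq x : infinite_set (seg x) -> seg x `*` seg x #<= seg x.
  elim/(well_founded_ind wf): x => x IH inf.
  have [[y yx le]|H] := pselect (exists2 y, lt y x & seg x #<= seg y).
    have yinf : infinite_set (seg y) by move=> fin; apply: inf (card_le_finite le fin).
    apply: card_le_trans (card_le_square le) (card_le_trans (IH _ yx yinf) _).
    by apply: subset_card_le => z zy; apply: tr yx.
  apply: (card_le_square_initial wo) => // y yx le.
  by apply: H; exists y.
rewrite -setXTT; have [[y le]|H] := pselect (exists y, [set: T] #<= seg y).
  have yinf : infinite_set (seg y) by move=> fin; apply: Tinf (card_le_finite le fin).
  apply: card_le_trans (card_le_square le) (card_le_trans (segsq _ yinf) _).
  exact: card_leT.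
apply: (card_le_square_initial wo) => // [y _ le|y _].
  by apply: H; exists y.
exact: segsq.
Qed.

(** * Orientations and increasing cycles *)

Definition orient (K : Type) (lt up : K -> K -> Prop) (x y : K) : Prop :=
  (lt x y /\ up x y) \/ (lt y x /\ ~ up y x).

Lemma orient_complete (K : Type) (lt up : K -> K -> Prop) :
  strict_well_order lt -> orientation_of_complete (orient lt up).
Proof.
move=> [irr tr tot _]; split=> [x [] []|x y /tot[xy|yx]]; try by move/irr.
  have yx : ~ lt y x by move=> /(tr _ _ _ xy)/irr.
  have [u|u] := pselect (up x y).
    by left; split; [left|move=> [[]|[]]].
  by right; split; [right|move=> [[]|[]]].
have xy : ~ lt x y by move=> /(tr _ _ _ yx)/irr.
have [u|u] := pselect (up y x).
  by right; split; [left|move=> [[]|[]]].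
by left; split; [right|move=> [[]|[]]].
Qed.

(** Monotonicity along [lt] makes the vertices distinct; the closing arc is the one whose index
    wraps around modulo [n.+1]. *)
Lemma has_dicycle_increasing (K : Type) (lt D : K -> K -> Prop) (W : set K)
    (v : nat -> K) (n : nat) :
  strict_well_order lt ->
  (forall i, (i <= n)%N -> W (v i)) ->
  (forall i, (i < n)%N -> lt (v i) (v i.+1) /\ D (v i) (v i.+1)) ->
  D (v n) (v 0%N) -> has_dicycle D W n.+1.
Proof.
move=> [irr tr _ _] vW vD vn0; exists v; split; last split.
- have incr i j : (i < j)%N -> (j <= n)%N -> lt (v i) (v j).
    elim: j => // j IH; rewrite ltnS leq_eqVlt => /predU1P[->|ij] lj.
      by have [] := vD j lj.
    by apply: tr (IH ij (ltnW lj)) _; have [] := vD j lj.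
  move=> i j; rewrite !ltnS => li lj vij.
  case: (ltngtP i j) => // [/incr/(_ lj)|/incr/(_ li)];
  by rewrite vij => /irr.
- by move=> i; rewrite ltnS; apply: vW.
move=> i; rewrite ltnS leq_eqVlt => /predU1P[->|li]; first by rewrite modnn.
by rewrite modn_small //; have [] := vD i li.
Qed.

Definition unbounded (K : Type) (lt : K -> K -> Prop) (W : set K) : Prop :=
  forall b, exists2 x, W x & lt b x.

(** * Regular cardinals *)

Section Regular.
Variables (K : Type) (lt : K -> K -> Prop).
Hypotheses (Kcard : infinite_cardinal lt) (Kreg : regular_cardinal lt).

Lemma infinite_cardinal_strict_well_order : strict_well_order lt.
Proof. by case: Kcard => irr [tr [tot [wf _]]]; split. Qed.

Lemma not_bounded_card (A : set K) b : (forall a, A a -> lt a b) -> ~ ([set: K] #<= A).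
Proof.
move=> Ab le; case: Kcard => _ [_ [_ [_ [_ /(_ b)]]]]; apply.
by apply: card_le_trans le _; apply: subset_card_le.
Qed.

Lemma exists_greater b : exists c, lt b c.
Proof.
have [|c cP] := Kreg (A := [set b]); last by exists c; apply: cP.
move=> le; case: Kcard => _ [_ [_ [_ [Kinf _]]]]; apply: Kinf.
exact: card_le_finite le (finite_set1 b).
Qed.

Lemma exists_greater2 b c : exists d, lt b d /\ lt c d.
Proof.
have [irr tr tot _] := infinite_cardinal_strict_well_order.
have [b' bb'] := exists_greater b; have [c' cc'] := exists_greater c.
have [e|/tot[h|h]] := pselect (b' = c'); first by exists b'; split=> //; rewrite e.
  by exists c'; split=> //; apply: tr h.
by exists b'; split=> //; apply: tr h.
Qed.

(** Regularity gives one direction, the smallness of initial segments the other. *)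
Lemma unbounded_card (W : set K) : unbounded lt W <-> W #= [set: K].
Proof.
have [irr tr tot _] := infinite_cardinal_strict_well_order; split=> [Wunb|].
  apply/card_eqPle; split; first exact: card_leT.
  apply: contrapT => /Kreg[b bP]; have [x /bP xb bx] := Wunb b.
  by apply: (irr x); apply: tr xb bx.
move=> /card_eqPle[_ KW] b; have [c bc] := exists_greater b.
apply: contrapT => H; apply: (@not_bounded_card W c) KW => a Wa.
have [<-//|/tot[ba|ab]] := pselect (b = a); last exact: tr ab bc.
by case: H; exists a.
Qed.

(* If [A] were unbounded, thin it out to [range g] by recursion along [lt] so
   that no pair from [range g] has colour [i]. *)
Lemma bounded_avoiding (f : K -> K -> bool) (A W : set K) (i : bool) :
  (forall A B : set K, A #= [set: K] -> B #= [set: K] ->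
     exists a b, A a /\ B b /\ lt a b /\ f a b = i) ->
  A `<=` W ->
  (forall a, A a -> ~ unbounded lt [set b | [/\ W b, lt a b & f a b = i]]) ->
  ~ unbounded lt A.
Proof.
move=> fP AW Abd Aunb.
have [irr tr tot wf] := infinite_cardinal_strict_well_order.
(* [h a] bounds the later points of [W] joined to [a] in colour [i]. *)
have /choice[h hP] (a : K) : exists h, A a ->
    forall b, W b -> lt a b -> f a b = i -> ~ lt h b.
  have [Aa|] := pselect (A a); last by exists a.
  apply: contrapT => H; apply: (Abd a Aa) => c; apply: contrapT => H'.
  apply: H; exists c => _ b Wb ab fab cb; apply: H'.
  by exists b.
have K0 : inhabited K.
  by case: Kcard => _ [_ [_ [_ [/infinite_setN0[x _] _]]]].
pose Phi (S : set K) b := A b /\ forall s, S s -> lt s b /\ lt (h s) b.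
have [g gP] := wf_recursive_choice Phi wf K0.
have {}gP p : A (g p) /\ forall q, lt q p -> lt (g q) (g p) /\ lt (h (g q)) (g p).
  have [|Agp H] := gP p; last by split=> // q qp; apply: H; exists q.
  have small (k : K -> K) : ~ ([set: K] #<= k @` [set q | lt q p]).
    move=> le; apply: (@not_bounded_card [set q | lt q p] p) => //.
    exact: card_le_trans le (card_image_le _ _).
  have [b1 b1P] := Kreg (small g); have [b2 b2P] := Kreg (small (h \o g)).
  have [c [b1c b2c]] := exists_greater2 b1 b2; have [b Ab cb] := Aunb c.
  exists b; split=> // s [q /= qp <-]; split; apply: (tr _ _ _ _ cb).
    by apply: tr b1c; apply: b1P; exists q.
  by apply: tr b2c; apply: b2P; exists q.
have gK : range g #= [set: K].
  apply: inj_card_eq => x y _ _ e; apply: contrapT => /tot[xy|yx].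
    by have [_ /(_ _ xy)[+ _]] := gP y; rewrite e => /irr.
  by have [_ /(_ _ yx)[+ _]] := gP x; rewrite e => /irr.
(* A pair of colour [i] in [range g] is absurd: its larger point lies beyond [h] of the smaller
   one. *)
have [_ [_ [[p _ <-] [[q _ <-] [gpq fpq]]]]] := fP _ _ gK gK.
have [Agp gltp] := gP p; have [Agq gltq] := gP q.
apply: (hP _ Agp _ (AW _ Agq) gpq fpq).
have [e|/tot[pq|/gltp[gqp _]]] := pselect (p = q).
- by move: gpq; rewrite e => /irr.
- by have [] := gltq _ pq.
- by case: (irr (g p)); apply: tr gqp.
Qed.

Lemma regular_dicycles (f : K -> K -> bool) (W : set K) (n : nat) :
  (forall A B : set K, A #= [set: K] -> B #= [set: K] ->
     forall i, exists a b, A a /\ B b /\ lt a b /\ f a b = i) ->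
  unbounded lt W -> has_dicycle (orient lt f) W n.+3.
Proof.
move=> fP Wunb; have wo := infinite_cardinal_strict_well_order.
have [irr tr tot wf] := wo.
pose good (i : bool) x := unbounded lt [set y | [/\ W y, lt x y & f x y = i]].
have bd i : exists b, forall x, W x -> lt b x -> good i x.
  apply: contrapT => H.
  apply: (@bounded_avoiding f [set x | W x /\ ~ good i x] W i).
  - by move=> A B AK BK; apply: fP.
  - by move=> x [].
  - by move=> x [].
  move=> b; apply: contrapT => H'; apply: H; exists b => x Wx bx.
  by apply: contrapT => ng; apply: H'; exists x.
have [b1 b1P] := bd true; have [b0 b0P] := bd false.
have [c [b1c b0c]] := exists_greater2 b1 b0.
have {b1P b1c} goodT x : W x -> lt c x -> good true x.
  by move=> Wx cx; apply: b1P => //; apply: (tr _ _ _ _ cx).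
have {b0P b0c} goodF x : W x -> lt c x -> good false x.
  by move=> Wx cx; apply: b0P => //; apply: (tr _ _ _ _ cx).
have [x0 Wx0 cx0] := Wunb c.
have /choice[nx nxP] (x : K) : exists y, W x /\ lt c x ->
    [/\ W y, lt x y & f x y = true].
  have [[Wx cx]|] := pselect (W x /\ lt c x); last by exists x.
  by have [y yP _] := goodT x Wx cx x; exists y.
pose w i := iter i nx x0.
have wW i : W (w i) /\ lt c (w i).
  elim: i => [//|i [Wi ci]]; have [//|Wi1 ii1 _] := nxP (w i).
  by split=> //; apply: tr ci ii1.
have ws i : lt (w i) (w i.+1) /\ f (w i) (w i.+1) = true.
  by have [//|_ ? ?] := nxP (w i).
(* The cycle is [w 0], ..., [w n], [a], [b]: here [a] ranges over the upward neighbours of [w n],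
   [b] over the points with a downward arc to [x0], and the rectangle supplies the arc from [a] to
   [b]. *)
have A_ := (unbounded_card _).1 (goodT _ (wW n).1 (wW n).2).
have B_ := (unbounded_card _).1 (goodF _ Wx0 cx0).
have [a [b [[Wa na fa] [[Wb x0b fb] [ab fab]]]]] := fP _ _ A_ B_ true.
pose v i := if (i <= n)%N then w i else if i == n.+1 then a else b.
have vW i : W (v i).
  by rewrite /v; case: ifP => _; [case: (wW i)|case: ifP].
apply: (has_dicycle_increasing (lt := lt) (v := v)) => // [i|].
  rewrite !ltnS leq_eqVlt => /predU1P[->|].
    have n2 : (n.+2 <= n)%N = false by rewrite leqNgt ltnS leqnSn.
    by rewrite /v ltnn n2 eqxx gtn_eqF //; split=> //; left; rewrite fab.
  rewrite ltnS leq_eqVlt => /predU1P[->|li].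
    by rewrite /v leqnn ltnn eqxx; split=> //; left; rewrite fa.
  rewrite /v (ltnW li) li; have [wi fi] := ws i.
  by split=> //; left; rewrite fi.
have n2 : (n.+2 <= n)%N = false by rewrite leqNgt ltnS leqnSn.
by rewrite /v n2 gtn_eqF //=; right; split=> //; rewrite fb.
Qed.

End Regular.

(** * Ladders and stationary sets *)

Section Ladders.
Variables (L K : Type) (lt : K -> K -> Prop).
Hypothesis wo : strict_well_order lt.

Lemma le_lt_trans x y z : ~ lt y x -> lt y z -> lt x z.
Proof.
have [irr tr tot _] := wo => yx yz.
have [->//|/tot[xy|/yx//]] := pselect (x = y).
exact: tr xy yz.
Qed.

Lemma lt_le_trans x y z : lt x y -> ~ lt z y -> lt x z.
Proof.
have [irr tr tot _] := wo => xy zy.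
have [<-//|/tot[yz|/zy//]] := pselect (y = z).
exact: tr xy yz.
Qed.

Lemma max2 x y : exists z, [/\ z = x \/ z = y, ~ lt z x & ~ lt z y].
Proof.
have [irr tr tot _] := wo; have [xy|xy] := pselect (lt x y).
  by exists y; split; [right|move=> /(tr _ _ _ xy)/irr|apply: irr].
by exists x; split; [left|apply: irr|].
Qed.

Lemma max_below (f : nat -> K) (m : nat) x y :
  lt x y -> (forall i, (i < m)%N -> lt (f i) y) ->
  exists z, [/\ lt z y, ~ lt z x & forall i, (i < m)%N -> ~ lt z (f i)].
Proof.
have [irr tr tot _] := wo => xy; elim: m => [_|m IH fy].
  by exists x; split=> //; apply: irr.
have [i im|z [zy zx zf]] := IH; first by apply/fy/ltnW.
have [u [uE uz ufm]] := max2 z (f m); exists u; split.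
- by case: uE => -> //; apply: fy.
- by move=> ux; apply: uz; apply: lt_le_trans ux zx.
move=> i; rewrite ltnS leq_eqVlt => /predU1P[->//|/zf zfi ufi].
by apply: uz; apply: lt_le_trans ufi zfi.
Qed.

(** Any order and repetitions are allowed, so a successor has a constant ladder; [limit_of_closed]
    discards it by asking for points strictly in between. *)
Definition ladder (s : nat -> K) (d : K) : Prop :=
  (forall n, lt (s n) d) /\ forall x, lt x d -> exists n, ~ lt (s n) x.

Definition closed_under (F : K -> K) (g : K) : Prop :=
  forall y, lt y g -> lt (F y) g.

Definition limit_of_closed (F : K -> K) (d : K) : Prop :=
  forall x, lt x d -> exists g, [/\ lt x g, lt g d & closed_under F g].

Variable r : K -> nat -> K.
Hypothesis r_ladder : forall d, (exists s, ladder s d) -> ladder (r d) d.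

(* Only points of cofinality omega count, and limits of closed points are used
   instead of closed points: in [stationary_split] this gives a closed [g < d]
   such that [r d] leaves [g] at some index [m], so that [r d m] exceeds every
   bound computed from [r d 0, ..., r d (m - 1)]. *)
Definition nonstationary (A : set K) : Prop :=
  exists F, forall d, A d -> ladder (r d) d -> ~ limit_of_closed F d.

(** Three forms of the regularity of $\lambda^+$, later derived from [succ_cardinal_bounded]. *)
Hypothesis bounded_fun : forall F : L -> K, exists z, forall l, lt (F l) z.
Hypothesis bounded_seq : forall F : nat -> K, exists z, forall n, lt (F n) z.
Hypothesis bounded_le : forall x (F : K -> K),
  exists z, forall y, ~ lt x y -> lt (F y) z.

Lemma exists_lub (s : nat -> K) : (forall n, lt (s n) (s n.+1)) ->
  exists d, ladder s d.
Proof.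
move=> sincr; have [irr tr tot wf] := wo.
have [d dub dmin] : exists2 d, (forall n, lt (s n) d) &
    forall y, lt y d -> ~ (forall n, lt (s n) y).
  by apply: (@wf_min _ lt (fun z => forall n, lt (s n) z) wf).
exists d; split=> // x /dmin H; apply: contrapT => H'; apply: H => n.
by apply: contrapT => nx; apply: H'; exists n.
Qed.

(** The supremum of an omega-iteration, each step passing all values of [F] up to the current point,
    is closed. *)
Lemma exists_closed_above (F : K -> K) x : exists2 g, lt x g & closed_under F g.
Proof.
have [irr tr tot wf] := wo.
have /choice[nx nxP] (y : K) : exists z, lt y z /\ forall u, ~ lt y u -> lt (F u) z.
  have [z1 z1P] := bounded_le y id; have [z2 z2P] := bounded_le y F.
  have [z [_ zz1 zz2]] := max2 z1 z2; exists z; split.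
    by apply: lt_le_trans zz1; apply/z1P/irr.
  by move=> u yu; apply: lt_le_trans zz2; apply: z2P.
pose s n := iter n nx x.
have [|d [sd dP]] := @exists_lub s; first by move=> n; apply: (nxP _).1.
exists d; first exact: (sd 0%N).
by move=> y /dP[n yn]; apply: tr (sd n.+1); apply: (nxP _).2.
Qed.

(** The supremum of an increasing sequence of closed points. Hence [K] itself is stationary. *)
Lemma exists_limit_of_closed (F : K -> K) : inhabited K ->
  exists2 d, ladder (r d) d & limit_of_closed F d.
Proof.
have [irr tr tot wf] := wo => -[x0].
have /choice[nx nxP] (x : K) : exists g, lt x g /\ closed_under F g.
  by have [g] := exists_closed_above F x; exists g.
pose s n := iter n nx x0.
have sincr n : lt (s n) (s n.+1) by apply: (nxP _).1.
have [d sd] := exists_lub sincr; exists d; first by apply: r_ladder; exists s.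
move=> x /sd.2[n xn]; exists (s n.+1); split.
- exact: le_lt_trans xn (sincr n).
- exact: sd.1.
- exact: (nxP _).2.
Qed.

Lemma limit_of_closedS (F G : K -> K) d :
  (forall y, ~ lt (F y) (G y)) -> limit_of_closed F d -> limit_of_closed G d.
Proof.
move=> GF dF x /dF[g [xg gd gF]]; exists g; split=> // y /gF Fy.
exact: le_lt_trans (GF y) Fy.
Qed.

(** A point closed under a function dominating all the witnesses is closed under each of them. *)
Lemma nonstationary_bigcup (A : L -> set K) :
  (forall l, nonstationary (A l)) -> nonstationary (\bigcup_l A l).
Proof.
have [irr tr tot wf] := wo.
move=> /choice[F FP]; have /choice[G GP] (y : K) := bounded_fun (F ^~ y).
exists G => d [l _ Ad] rd Gd; apply: (FP l d Ad rd).
by apply: limit_of_closedS Gd => y /(tr _ _ _ (GP y l))/irr.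
Qed.

Lemma nonstationaryS (A B : set K) : A `<=` B -> nonstationary B -> nonstationary A.
Proof. by move=> AB [F FP]; exists F => d /AB; apply: FP. Qed.

(** Test against the constant function [b]: a closed point with anything below it lies above [b]. *)
Lemma stationary_unbounded (A : set K) b : ~ nonstationary A ->
  exists x, [/\ A x, lt b x & forall n, lt (r x n) x].
Proof.
have [irr tr tot wf] := wo.
move=> Ast; apply: contrapT => H; apply: Ast; exists (fun=> b) => d Ad [rd _] dlim.
have [g [xg gd /(_ _ xg) bg]] := dlim _ (rd 0%N).
by apply: H; exists d; split=> //; apply: tr bg gd.
Qed.

(** * Prefixes of ladders and pressing down *)

Definition ext (s : seq K) : set K := [set d | mkseq (r d) (size s) = s].

Lemma take_mkseq (f : nat -> K) i m : (i <= m)%N ->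
  take i (mkseq f m) = mkseq f i.
Proof. by move=> im; rewrite /mkseq -map_take take_iota (minn_idPl im). Qed.

Lemma ext_mkseq d m : ext (mkseq (r d) m) d.
Proof. by rewrite /ext /mkset size_mkseq. Qed.

(** Induction on the length, with [bounded_le] for the first entry; [bounded_seq] then merges the
    bounds over all lengths. *)
Lemma bounded_finseq x (H : seq K -> K) :
  exists z, forall u, all (fun a => `[< ~ lt x a >]) u -> lt (H u) z.
Proof.
have [irr tr tot wf] := wo.
have bdn n : forall G : seq K -> K,
    exists z, forall u, size u = n -> all (fun a => `[< ~ lt x a >]) u -> lt (G u) z.
  elim: n => [|n IH] G.
    have [z zP] := bounded_seq (fun=> G [::]); exists z => -[|//] _ _.
    exact: (zP 0%N).
  have /choice[h hP] (a : K) := IH (fun u => G (a :: u)).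
  have [z zP] := bounded_le x h; exists z => -[//|a u] [un] /= /andP[/asboolP xa ua].
  exact: tr (hP a u un ua) (zP a xa).
have /choice[h hP] (n : nat) := bdn n H.
have [z zP] := bounded_seq h; exists z => u ux.
exact: tr (hP _ u erefl ux) (zP _).
Qed.

Lemma all_mkseq_le x (f : nat -> K) m : (forall i, (i < m)%N -> ~ lt x (f i)) ->
  all (fun a => `[< ~ lt x a >]) (mkseq f m).
Proof.
move=> xf; rewrite /mkseq all_map; apply/allP => i; rewrite mem_iota /= => im.
by apply/asboolP/xf.
Qed.

(** Otherwise each [t] has a bound [b t] past which one more entry gives a nonstationary set. One
    function [F] dominates these bounds and the witnesses [G]; a limit [d] of its closed points then
    falls into one of those sets and contradicts its witness. *)
Lemma stationary_split (A : set K) (s : seq K) :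
  ~ nonstationary (A `&` ext s) ->
  exists t, forall b, exists2 x, ~ lt x b & ~ nonstationary (A `&` ext (rcons (s ++ t) x)).
Proof.
have [irr tr tot wf] := wo => sst; apply: contrapT => H; apply: sst.
have /choice[b bP] (t : seq K) : exists b, forall x, ~ lt x b ->
    nonstationary (A `&` ext (rcons (s ++ t) x)).
  apply: contrapT => H'; apply: H; exists t => b; apply: contrapT => H''.
  apply: H'; exists b => x xb; apply: contrapT => nst; apply: H''.
  by exists x.
have /choice[G GP] (u : seq K) : exists F, nonstationary (A `&` ext u) ->
    forall d, (A `&` ext u) d -> ladder (r d) d -> ~ limit_of_closed F d.
  have [[F FP]|] := pselect (nonstationary (A `&` ext u)); last by exists id.
  by exists F.
have /choice[F FP] (y : K) : exists z, forall u, all (fun a => `[< ~ lt y a >]) u ->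
    lt (b (drop (size s) u)) z /\ forall y', ~ lt y y' -> lt (G u y') z.
  have /choice[h hP] (u : seq K) := bounded_le y (G u).
  have [z1 z1P] := bounded_finseq y (b \o drop (size s)).
  have [z2 z2P] := bounded_finseq y h.
  have [z [_ zz1 zz2]] := max2 z1 z2; exists z => u yu; split.
    exact: lt_le_trans (z1P u yu) zz1.
  by move=> y' yy'; apply: lt_le_trans zz2; apply: tr (hP u y' yy') (z2P u yu).
exists F => d [Ad sd] rd dlim; have [rlt rcof] := rd.
(* Going past the first [size s] entries ensures that the exit index [m] below is at least
   [size s]. *)
have [x [xd _ xs]] := max_below (f := r d) (m := size s) (rlt 0%N) (fun i _ => rlt i).
have [g [xg gd gF]] := dlim x xd.
have [m mP mmin] : exists2 m, ~ lt (r d m) g & forall i, (i < m)%N -> lt (r d i) g.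
  have [n ng] := rcof g gd.
  have ex : exists n, `[< ~ lt (r d n) g >] by exists n; apply/asboolP.
  case: (ex_minnP ex) => m /asboolP mg mmin; exists m => // i im.
  by apply: contrapT => /asboolP/mmin; rewrite leqNgt im.
have sm : (size s <= m)%N.
  by rewrite leqNgt; apply/negP => /xs xm; apply: mP; apply: le_lt_trans xm xg.
(* All entries before [m] are at most [y], so closedness of [g] puts [b t] below [g], hence below
   [r d m]. *)
have [y [yg _ yr]] := max_below xg mmin.
pose t := drop (size s) (mkseq (r d) m); pose u := mkseq (r d) m.+1.
have uE : u = rcons (s ++ t) (r d m).
  rewrite /u mkseqS -[mkseq _ _ in LHS](cat_take_drop (size s)); congr (rcons (_ ++ _) _).
  by rewrite take_mkseq.
have btm : ~ lt (r d m) (b t).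
  have [bF _] := FP y _ (all_mkseq_le yr) => h.
  by apply: mP; apply: tr h (tr _ _ _ bF (gF y yg)).
have := bP t _ btm; rewrite -uE => ust.
apply: (GP u ust d (conj Ad (ext_mkseq d m.+1)) rd).
move=> x' x'd.
(* Beyond all entries of [u], a point closed under [F] is closed under [G u]. *)
have [y0 [y0d y0x' y0r]] := max_below (m := m.+1) x'd (fun i _ => rlt i).
have [g' [y0g' g'd g'F]] := dlim y0 y0d; exists g'; split=> //.
  exact: le_lt_trans y0x' y0g'.
move=> z zg'; have [w [wE wz wy0]] := max2 z y0.
have wg' : lt w g' by case: wE => ->.
have [|_ GF] := FP w u; last by apply: tr (GF z wz) (g'F w wg').
by apply: all_mkseq_le => i im; move=> wi; apply: wy0; apply: lt_le_trans wi (y0r i im).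
Qed.

(** Asking for some [n] amounts to asking for the first one, since agreement below [n] includes
    agreement below smaller indices. *)
Definition up (x y : K) : Prop :=
  ~ exists n, ~ lt (r y n) x /\ forall i, (i < n)%N -> r x i = r y i.

Lemma ext_nth s d d' i : ext s d -> ext s d' -> (i < size s)%N -> r d i = r d' i.
Proof.
move=> sd sd' si; have := etrans sd (esym sd').
by move/(congr1 (nth d ^~ i)); rewrite !nth_mkseq.
Qed.

Lemma ext_last s x d : ext (rcons s x) d -> r d (size s) = x.
Proof.
by rewrite /ext /mkset size_rcons mkseqS => /(congr1 (last x)); rewrite !last_rcons.
Qed.

Lemma ext_cat s t d : ext (s ++ t) d -> ext s d.
Proof.
rewrite /ext /mkset size_cat => /(congr1 (take (size s))).
by rewrite take_size_cat // take_mkseq // leq_addr.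
Qed.

Lemma ext_rcons s x d : ext (rcons s x) d -> ext s d.
Proof. by rewrite -cats1; apply: ext_cat. Qed.

(** The point [z] shows that the entries of [r y] up to index [size t] lie below [x]; a downward arc
    would thus need agreement at [size t], where the entries are [a] and [b]. *)
Lemma up_of_split t a b x y z :
  a <> b -> ext (rcons t a) x -> ext (rcons t b) y ->
  ext (rcons t b) z -> (forall i, lt (r z i) z) -> lt z x -> up x y.
Proof.
have [irr tr tot wf] := wo.
move=> ab xa yb zb rz zx [n [nx agree]].
have [nt|/agree] := leqP n (size t).
  apply: nx; rewrite (ext_nth yb zb); first exact: tr (rz n) zx.
  by rewrite size_rcons.
by rewrite (ext_last xa) (ext_last yb).
Qed.

Lemma stationary_dicycles (W : set K) (n : nat) :
  ~ nonstationary W -> has_dicycle (orient lt up) W n.+3.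
Proof.
have [irr tr tot wf] := wo => Wst.
have [|t tP] := @stationary_split W [::].
  by move: Wst; apply: contra_not; apply: nonstationaryS => d Wd; split.
rewrite cat0s in tP.
have [b0 _] : exists b : K, True.
  apply: contrapT => H; apply: Wst; exists id => d; case: H; by exists d.
(* Three classes are needed: the ends of the path use [x1], its inner points alternate between [x2]
   and [x3], so neighbours differ for either parity of [n]. *)
have [x1 _ st1] := tP b0; have [b1 [_ x1b1 _]] := stationary_unbounded x1 Wst.
have [x2 b1x2 st2] := tP b1; have [b2 [_ x2b2 _]] := stationary_unbounded x2 Wst.
have [x3 b2x3 st3] := tP b2.
have x12 : lt x1 x2 by apply: lt_le_trans b1x2.
have x23 : lt x2 x3 by apply: lt_le_trans b2x3.
have n12 : x1 <> x2 by move=> e; move: x12; rewrite e => /irr.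
have n23 : x2 <> x3 by move=> e; move: x23; rewrite e => /irr.
have n13 : x1 <> x3 by move=> e; move: (tr _ _ _ x12 x23); rewrite e => /irr.
(* One member of each class, to play [z] in [up_of_split] for all points beyond [c]. *)
have [c1 [[_ c1t] _ rc1]] := stationary_unbounded b0 st1.
have [c2 [[_ c2t] c12 rc2]] := stationary_unbounded c1 st2.
have [c [[_ ct] c2c rc]] := stationary_unbounded c2 st3.
pose S := [set x1; x2; x3].
have upS e e' x y : S e' -> e <> e' ->
    ext (rcons t e) x -> ext (rcons t e') y -> lt c x -> up x y.
  move=> Se' ee' xe ye' cx; have c2x := tr _ _ _ c2c cx.
  case: Se' => [[]|] E; rewrite {}E in ee' ye'.
  - exact: up_of_split xe ye' c1t rc1 (tr _ _ _ c12 c2x).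
  - exact: up_of_split xe ye' c2t rc2 c2x.
  - exact: up_of_split xe ye' ct rc cx.
have [t' t'P] := stationary_split st1.
set s := rcons t x1 ++ t' in t'P.
have [x0 _ st0] := t'P b0.
have [w0 [[Ww0 w0s] cw0 _]] := stationary_unbounded c st0.
have /choice[nx nxP] (p : bool * K) : exists y,
    [/\ W y, lt p.2 y & ext (rcons t (if p.1 then x2 else x3)) y].
  case: p => [[] x] /=.
    by have [y [[]]] := stationary_unbounded x st2; exists y.
  by have [y [[]]] := stationary_unbounded x st3; exists y.
pose w := fix w i := if i is j.+1 then nx (odd j, w j) else w0.
have wlt i : lt (w i) (w i.+1) by have [] := nxP (odd i, w i).
have cw i : lt c (w i) by elim: i => // i IH; apply: tr IH (wlt i).
have wW i : W (w i) by case: i => // i; have [] := nxP (odd i, w i).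
pose e i := if i is j.+1 then (if odd j then x2 else x3) else x1.
have we i : ext (rcons t (e i)) (w i).
  case: i => [|i]; last by have [] := nxP (odd i, w i).
  by apply: ext_cat (ext_rcons w0s).
have eS i : S (e i).
  case: i => [|i] /=; first by left; left.
  by case: ifP => _; [left; right|right].
have ee i : e i <> e i.+1.
  by case: i => [|i] /=; [|case: (odd i) => //=; apply: nesym].
(* [w0] and [last] both extend [s], and the next ladder entry of [last] is [z], not below [w0]: this
   makes the closing arc go down. *)
have [z w0z stz] := t'P w0.
have [last [[Wlast lasts] wlast _]] := stationary_unbounded (w n.+1) stz.
pose v i := if (i <= n.+1)%N then w i else last.
apply: (has_dicycle_increasing (lt := lt) (v := v)) => // [i _|i|].
- by rewrite /v; case: ifP.
- rewrite ltnS leq_eqVlt => /predU1P[->|li].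
    rewrite /v leqnn ltnn; split=> //; left; split=> //.
    apply: (upS (e n.+1) x1) => //; first by left; left.
      by move=> /=; case: (odd n); apply: nesym.
    exact: ext_cat (ext_rcons lasts).
  rewrite /v (ltnW li) li; split=> //; left; split=> //.
  exact: upS (ee i) (we i) (we i.+1) (cw i).
rewrite /v ltnn /=; right; split; last first.
  move=> H; apply: H; exists (size s); rewrite (ext_last lasts); split=> // i si.
  exact: ext_nth (ext_rcons w0s) (ext_rcons lasts) si.
have w0w i : lt w0 (w i.+1) by elim: i => [|i IH]; [apply: (wlt 0%N)|apply: tr IH (wlt _)].
exact: tr (w0w n) wlast.
Qed.

End Ladders.

(** * Successor cardinals *)

Section Successor.
Variables (L K : Type).
Hypotheses (Linf : infinite_set [set: L]) (LK : succ_cardinal L K).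

(* Restrict a well-order of [K] to its least initial segment of size [|K|]. *)
Lemma succ_cardinal_order : exists lt : K -> K -> Prop,
  strict_well_order lt /\ forall x, [set y | lt y x] #<= [set: L].
Proof.
have [_ [_ small]] := LK; have [lt wo] := exists_strict_well_order K.
have [[x0 x0P]|H] := pselect (exists x, [set: K] #<= [set y | lt y x]); last first.
  exists lt; split=> // x; have [//|h] := small [set y | lt y x].
  by case: H; exists x.
have [_ _ _ wf] := wo.
have [x1 x1P x1min] : exists2 x, [set: K] #<= [set y | lt y x] &
    forall y, lt y x -> ~ ([set: K] #<= [set z | lt z y]).
  by apply: (@wf_min _ lt (fun x => [set: K] #<= [set y | lt y x]) wf); exists x0.
have K0 : [set: K] !=set0 by exists x0.
have [g [gx1 ginj']] := inj_of_card_le K0 x1P.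
have ginj : injective g by move=> x y; apply: ginj'.
exists (fun x y => lt (g x) (g y)); split; first exact: strict_well_order_inj.
move=> x; have [gxL|/(x1min _ (gx1 x I))//] := small [set y | lt y (g x)].
by apply: card_le_trans _ gxL; apply: (card_le_of_inj (f := g)) => // y z _ _ /ginj.
Qed.

Variable lt : K -> K -> Prop.
Hypotheses (wo : strict_well_order lt)
  (seg_small : forall x, [set y | lt y x] #<= [set: L]).

Lemma le_seg_small x : [set y | ~ lt x y] #<= [set: L].
Proof.
have [irr tr tot _] := wo.
apply: card_le_trans (card_le_setU1 x Linf (seg_small x)).
apply: subset_card_le => y /= xy; have [->|/tot[]//] := pselect (y = x); first by right.
by left.
Qed.

(** If [F] were unbounded on [S], each [x] would lie at or below some [F (j x)]. Coding [x] by [j x]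
    and its place in that segment injects [K] into [L * L], hence into [L]. *)
Lemma succ_cardinal_bounded (I : Type) (S : set I) (F : I -> K) :
  S #<= [set: L] -> exists z, forall i, S i -> lt (F i) z.
Proof.
move=> SL; have [irr tr tot _] := wo; have [_ [nKL _]] := LK.
apply: contrapT => H; apply: nKL.
have /choice[j jP] (x : K) : exists i, S i /\ ~ lt (F i) x.
  apply: contrapT => H'; apply: H; exists x => i Si; apply: contrapT => h.
  by apply: H'; exists i.
have [[x0 _]|K0] := pselect ([set: K] !=set0); last first.
  suff -> : [set: K] = set0 by apply: card_ge0.
  by apply/seteqP; split=> // x _; apply: K0; exists x.
have S0 : S !=set0 by exists (j x0); case: (jP x0).
have [e [_ einj]] := inj_of_card_le S0 SL.
have /choice[k kP] (i : I) : exists k : K -> L, forall x y,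
    ~ lt (F i) x -> ~ lt (F i) y -> k x = k y -> x = y.
  have Fi0 : [set y | ~ lt (F i) y] !=set0 by exists (F i); apply: irr.
  by have [k [_ kinj]] := inj_of_card_le Fi0 (le_seg_small (F i)); exists k.
apply: card_le_trans (card_le_square_infinite Linf).
apply: (card_le_of_inj (f := fun x => (e (j x), k (j x) x))) => // x y _ _ [].
have [Sx xF] := jP x; have [Sy yF] := jP y.
by move=> /(einj _ _ Sx Sy) E; rewrite E in xF *; apply: kP.
Qed.

End Successor.

(** A stationary colour class serves every [n] at once; if there were none, [K] would be a union of
    $\lambda$ nonstationary sets. *)
Lemma succ_cardinal_dicycles (L K : Type) :
  infinite_set [set: L] -> succ_cardinal L K ->
  exists D : K -> K -> Prop, orientation_of_complete D /\
    forall c : K -> L, exists col : L, forall n : nat,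
      has_dicycle D [set x | c x = col] n.+3.
Proof.
move=> Linf LK; have [lt [wo small]] := succ_cardinal_order LK.
have bL (F : L -> K) : exists z, forall l, lt (F l) z.
  have [z zP] := succ_cardinal_bounded Linf LK wo small F (card_lexx _).
  by exists z => l; apply: zP.
have bN (F : nat -> K) : exists z, forall n, lt (F n) z.
  have := Linf => /infiniteP NL.
  have [z zP] := succ_cardinal_bounded Linf LK wo small F NL.
  by exists z => n; apply: zP.
have bK x (F : K -> K) : exists z, forall y, ~ lt x y -> lt (F y) z.
  have Sx := le_seg_small Linf wo small x.
  have [z zP] := succ_cardinal_bounded Linf LK wo small F Sx.
  by exists z => y; apply: zP.
(* Points without a ladder get a constant default, which [nonstationary] ignores. *)
have /choice[r rP] (d : K) : exists s, (exists s, ladder lt s d) -> ladder lt s d.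
  have [[s sd]|nd] := pselect (exists s, ladder lt s d); first by exists s.
  by exists (fun=> d) => /nd.
have [k0 _] : [set: K] !=set0.
  apply/set0P/negP => /eqP K0; have [_ [nKL _]] := LK; apply: nKL.
  by rewrite K0.
exists (orient lt (up lt r)); split; first exact: orient_complete.
move=> c.
have [col colP] : exists col, ~ nonstationary lt r [set x | c x = col].
  apply: contrapT => H.
  have : nonstationary lt r (\bigcup_l [set x | c x = l]).
    apply: nonstationary_bigcup => // l; apply: contrapT => h.
    by apply: H; exists l.
  move=> [F FP]; have [d rd dF] := exists_limit_of_closed wo rP bN bK F (inhabits k0).
  by apply: FP rd dF; exists (c d).
by exists col => n; apply: stationary_dicycles.
Qed.

Theorem theorem4p1 :
  (forall (K : Type) (lt : K -> K -> Prop),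
     infinite_cardinal lt -> regular_cardinal lt -> neg_sq_bracket lt ->
     exists D : K -> K -> Prop, orientation_of_complete D /\
       forall W : set K, W #= [set: K] ->
         forall n : nat, (3 <= n)%N -> has_dicycle D W n) /\
  (forall (L K : Type), uncountable_type L -> succ_cardinal L K ->
     exists D : K -> K -> Prop, orientation_of_complete D /\
       forall c : K -> L, forall n : nat, (3 <= n)%N ->
         exists col : L, has_dicycle D [set x | c x = col] n).
Proof.
split=> [K lt Kcard Kreg [f fP]|L K Lunc LK].
  exists (orient lt f); split.
    exact/orient_complete/infinite_cardinal_strict_well_order.
  move=> W WK [|[|[|n]]] // _; apply: regular_dicycles => //.
  exact/unbounded_card.
have Linf : infinite_set [set: L] by move=> /finite_set_countable.
have [D [Dor Dcyc]] := succ_cardinal_dicycles Linf LK.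
by exists D; split=> // c [|[|[|n]]] // _; have [col colP] := Dcyc c; exists col.
Qed.
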